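(* Let $X=\mathrm{sh}\bigcup\bigoplus_{i=1}^\infty i\mathbb{Z}$ be the shift union of $\bigoplus_{i=1}^\infty i\mathbb{Z}$. Then $\operatorname{trasdim}X\le\omega+1$.
   Context: Shift union: let $d_1$ be the metric on $(\bigoplus_{i\in\mathbb{Z}}\mathbb{Z})\times\mathbb{Z}$ given by $d_1\big(((x_i)_{i\in\mathbb{Z}},a),((y_i)_{i\in\mathbb{Z}},b)\big)=\sum_{i\in\mathbb{Z}}|x_i-y_i|+|b-a|$. For $j\in\mathbb{Z}$ let $X_j$ be the set of all $((x_i)_{i\in\mathbb{Z}},j)\in(\bigoplus_{i\in\mathbb{Z}}\mathbb{Z})\times\mathbb{Z}$ such that $x_i=0$ for $i<j$ and $x_i\in(i-j+1)\mathbb{Z}$ for $i\ge j$. Then $\mathrm{sh}\bigcup\bigoplus_{i=1}^\infty i\mathbb{Z}=\bigcup_{j\in\mathbb{Z}}X_j$ with the metric induced by $d_1$. For subsets $U,V$ of a metric space $(X,d)$, $\operatorname{diam}U=\sup\{d(x,y):x,y\in U\}$ and $d(U,V)=\inf\{d(x,y):x\in U,y\in V\}$. A family $\mathcal{U}$ of subsets is uniformly bounded if there is $R>0$ with $\operatorname{diam}U\le R$ for all $U\in\mathcal{U}$, and $r$-disjoint if $d(U,V)\ge r$ for all $U\ne V$ in $\mathcal{U}$. Transfinite asymptotic dimension: let $Fin\,\mathbb{N}$ be the collection of finite nonempty subsets of $\mathbb{N}$. For $M\subseteq Fin\,\mathbb{N}$ and $a\in\mathbb{N}$ let $M^a=\{\tau\in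 Fin\,\mathbb{N}:\tau\cup\{a\}\in M,\ a\notin\tau\}$. Define inductively: $\operatorname{Ord}M=0$ iff $M=\varnothing$; $\operatorname{Ord}M\le\alpha$ iff $\operatorname{Ord}M^a<\alpha$ for all $a\in\mathbb{N}$ (for ordinals $\alpha>0$); $\operatorname{Ord}M=\alpha$ iff $\operatorname{Ord}M\le\alpha$ and not $\operatorname{Ord}M<\alpha$; $\operatorname{Ord}M=\infty$ iff $\operatorname{Ord}M\le\alpha$ for no ordinal $\alpha$. For a metric space $(X,d)$ let $A(X,d)$ be the set of all $\sigma\in Fin\,\mathbb{N}$ such that there are no uniformly bounded families $\mathcal{U}_i$ $(i\in\sigma)$ of subsets of $X$ with each $\mathcal{U}_i$ $i$-disjoint and $\bigcup_{i\in\sigma}\mathcal{U}_i$ covering $X$. Then $\operatorname{trasdim}X=\operatorname{Ord}A(X,d)$. *)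

(* Defs.v *)
From HB Require Import structures.
From mathcomp Require Import all_boot all_order all_algebra finmap.
From mathcomp Require Import all_classical all_reals all_analysis.

Set Implicit Arguments.
Unset Strict Implicit.
Unset Printing Implicit Defensive.

Import Order.TTheory GRing.Theory Num.Theory.

Local Open Scope classical_set_scope.
Local Open Scope ring_scope.

(* Ordinals as well-founded trees: [OSup f] denotes the least ordinal greater
   than all the [f i], so every ordinal is denoted, in general by many trees;
   equality of ordinals is [ole x y /\ ole y x]. *)
Inductive ord : Type := OSup (A : Type) (f : A -> ord).

Fixpoint ole (x y : ord) {struct x} : Prop :=
  match x, y with
  | OSup A f, OSup B g => forall i : A, exists j : B, ole (f i) (g j)
  end.

Definition olt (x y : ord) : Prop :=
  match y with OSup B g => exists j : B, ole x (g j) end.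

Definition ozero : ord := OSup (fun e : Empty_set => match e with end).
Definition osucc (x : ord) : ord := OSup (fun _ : unit => x).
Definition ord_of_nat (n : nat) : ord := iter n osucc ozero.
Definition omega : ord := OSup ord_of_nat.

Lemma ole_refl x : ole x x.
Proof. by elim: x => A f IH /= i; exists i. Qed.

Lemma ole_trans y x z : ole x y -> ole y z -> ole x z.
Proof.
elim: x y z => A f IH [B g] [C h] /= fg gh i.
have [j fgj] := fg i; have [k ghk] := gh j.
by exists k; exact: IH fgj ghk.
Qed.

Lemma olt_wf : well_founded olt.
Proof.
suff H x y : ole y x -> Acc olt y by move=> x; exact: H (ole_refl x).
elim: x y => A f IH [B g] gf; constructor => z [j zg].
by have [i gfi] := gf j; apply: (IH i); exact: ole_trans zg gfi.
Qed.

Lemma ole_total x y : ole x y \/ olt y x.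
Proof.
elim: x y => A f IH [B g] /=.
have [?|H] := pselect (exists i, ole (OSup g) (f i)); [by right|left=> i].
apply: contrapT => N; apply: H; exists i.
case fi: (f i) => [C h] j; case: (IH i (g j)) => [fg|]; last by rewrite fi.
by case: N; exists j.
Qed.

Section TransfiniteOrder.
Local Open Scope fset_scope.

Definition FinN : set {fset nat} := [set s | s != fset0].

(* M^a *)
Definition link (M : set {fset nat}) (a : nat) : set {fset nat} :=
  [set t | [/\ FinN t, M (t `|` [fset a]) & a \notin t]].

(* [Ord_le M x] is Ord M <= x, where Ord M < x is read as Ord M <= y for some
   y < x, and Ord M <= 0 as Ord M = 0, that is, M empty. *)
Inductive Ord_le : set {fset nat} -> ord -> Prop :=
| Ord_le_zero M x : ole x ozero -> M = set0 -> Ord_le M x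
| Ord_le_pos M x : olt ozero x ->
    (forall a : nat, exists2 y, olt y x & Ord_le (link M a) y) -> Ord_le M x.

End TransfiniteOrder.

Section AsymptoticDimension.
Variables (R : realType) (X : metricType R).
Implicit Types (U V : set X) (F : set (set X)).

(* With values in the extended reals, so that the empty subset has diameter -oo
   and is at distance +oo from every subset. *)
Definition diam U : \bar R := ereal_sup [set (mdist x y)%:E | x in U & y in U].
Definition set_dist U V : \bar R :=
  ereal_inf [set (mdist x y)%:E | x in U & y in V].

Definition uniformly_bounded F : Prop :=
  exists2 r : R, 0 < r & forall U, F U -> (diam U <= r%:E)%E.

Definition disjoint_family (r : R) F : Prop :=
  forall U V, F U -> F V -> U <> V -> (r%:E <= set_dist U V)%E.

(* A(X, d). Whether 0 counts as a natural number is immaterial: the family of all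
   singletons is 0-disjoint, so no element of [asdim_set] contains 0. *)
Definition asdim_set : set {fset nat} :=
  [set s | FinN s /\
    ~ exists F : nat -> set (set X),
        (forall i, i \in s ->
           uniformly_bounded (F i) /\ disjoint_family i%:R (F i)) /\
        \bigcup_(i in [set` s]) \bigcup_(U in F i) U = [set: X]].

Definition trasdim_le (x : ord) : Prop := Ord_le asdim_set x.

End AsymptoticDimension.

(* A subset of a metric space, with the induced metric. *)
Section InducedMetric.
Variables (R : realType) (X : metricType R) (A : set X).

Let sub_mdist (x y : A) : R := mdist (val x) (val y).

Let sub_mdist_ge0 x y : 0 <= sub_mdist x y.
Proof. exact: mdist_ge0. Qed.

Let sub_mdist_positivity x y : sub_mdist x y = 0 -> x = y.
Proof. by move/mdist_positivity/val_inj. Qed.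

Let ballE_sub_mdist (x : A) d : ball x d = [set y | sub_mdist x y < d].
Proof. by rewrite -[ball x d]/(val @^-1` (ball (val x) d : set X)) ballEmdist. Qed.

HB.instance Definition _ := PseudoMetric_isMetric.Build R (set_type A)
  sub_mdist_ge0 sub_mdist_positivity ballE_sub_mdist.

Lemma mdist_set_val (x y : A) : mdist x y = mdist (val x) (val y).
Proof. by []. Qed.

End InducedMetric.

Definition dsumZ : Type := {fsfun int -> int with 0}.

HB.instance Definition _ := Choice.on dsumZ.

Definition d1 (p q : dsumZ * int) : int :=
  \sum_(i \in [set: int]) `|p.1 i - q.1 i| + `|q.2 - p.2|.

Lemma d1E (A : {fset int}) (p q : dsumZ * int) :
    (finsupp p.1 `<=` A)%fset -> (finsupp q.1 `<=` A)%fset ->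
  d1 p q = \sum_(i <- A) `|p.1 i - q.1 i| + `|q.2 - p.2|.
Proof.
move=> /fsubsetP pA /fsubsetP qA; rewrite /d1 (fsbigTE A)// => i iA.
by rewrite !fsfun_dflt ?subrr ?normr0//; apply: contraNN iA; [exact: qA|exact: pA].
Qed.

(* (\bigoplus_Z Z) x Z with the metric d1; the parameter R only serves to view
   the distances as elements of R. *)
Definition dsumZ_x_Z (R : realType) : Type := (dsumZ * int)%type.

Section D1Metric.
Variable R : realType.
Implicit Types p q s : dsumZ_x_Z R.

HB.instance Definition _ := Choice.on (dsumZ_x_Z R).

Let d1R p q : R := (d1 p q)%:~R.

Let d1R_xx p : d1R p p = 0.
Proof. by rewrite /d1R /d1 fsbig1 ?subrr ?normr0// => i _; rewrite subrr normr0. Qed.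

Let d1R_positivity p q : d1R p q = 0 -> p = q.
Proof.
move/eqP; rewrite intr_eq0.
rewrite (@d1E (finsupp p.1 `|` finsupp q.1)%fset) ?fsubsetUl ?fsubsetUr//.
rewrite paddr_eq0 ?sumr_ge0//= psumr_eq0// normr_eq0 subr_eq0.
move=> /andP[/allP H /eqP e2].
case: p q H e2 => [x a] [y b] /= H ->; congr pair.
apply/fsfunP => i; have [|iN] := boolP (i \in finsupp x `|` finsupp y)%fset.
  by move=> /H /=; rewrite normr_eq0 subr_eq0 => /eqP.
by move: iN; rewrite in_fsetU negb_or => /andP[ix iy]; rewrite !fsfun_dflt.
Qed.

Let d1R_sym p q : d1R p q = d1R q p.
Proof.
rewrite /d1R /d1 distrC; congr (_ + _)%:~R.
by apply: eq_fsbigr => i _; rewrite distrC.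
Qed.

Let d1R_triangle q p s : d1R p s <= d1R p q + d1R q s.
Proof.
pose A := (finsupp p.1 `|` finsupp q.1 `|` finsupp s.1)%fset.
have pA : (finsupp p.1 `<=` A)%fset by rewrite /A -fsetUA fsubsetUl.
have qA : (finsupp q.1 `<=` A)%fset.
  by rewrite /A fsetUAC fsubsetUr.
have sA : (finsupp s.1 `<=` A)%fset by rewrite fsubsetUr.
rewrite /d1R -intrD ler_int !(@d1E A)// addrACA -big_split/= lerD//.
  by apply: ler_sum => i _; exact: ler_distD.
by rewrite addrC; exact: ler_distD.
Qed.

HB.instance Definition _ := isMetric.Build R (dsumZ_x_Z R)
  d1R_xx d1R_positivity d1R_sym d1R_triangle.

Lemma mdist_d1 p q : mdist p q = (d1 p q)%:~R :> R.
Proof. by []. Qed.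

End D1Metric.

Definition sh_layer (R : realType) (j : int) : set (dsumZ_x_Z R) :=
  [set p : dsumZ_x_Z R | [/\ p.2 = j,
               forall i : int, i < j -> p.1 i = 0 &
               forall i : int, j <= i -> (i - j + 1 %| p.1 i)%Z]].

Arguments sh_layer R j : clear implicits.

Definition shift_union (R : realType) : set (dsumZ_x_Z R) :=
  \bigcup_(j : int) sh_layer R j.

Arguments shift_union R : clear implicits.

(* Main.v *)
(** Group the layers into blocks of [k] consecutive ones.  In a block starting at
    layer [b], call the coordinates [b <= i < b + width], [width = k * k + k],
    the head of a point and the later ones its tail.  Tails in one layer that
    differ are more than [k * k] apart, so a [k]-chain of tails within a block
    contains at most one tail per layer; hence the components ("tiles") of the
    tails at scale [k] have diameter at most [k * k].  The tails within a bounded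
    distance of each other can be told apart by finitely many colors, and the
    color of its tile gives every point a shift.

    Cut the space of heads into cubes of side [period] on a grid translated by
    the shift.  The points far from the grid form, over the blocks of even and of
    odd index, two [k]-disjoint families.  For the others fix a direction [e] in
    which the head is close to the grid.  Two such points that are close and lie
    in different tiles of one block have different shifts, so their [e]-th head
    coordinates are at distance at least [r]; if they lie in different blocks whose
    indices are congruent modulo [width], then the [e]-th head coordinate of the
    earlier block vanishes on the later one, but is at least [r] in absolute value
    on the earlier one.  Splitting further by the parities of the heads in a grid
    of side [r] leaves bounded [r]-disjoint families, whose number depends on [k]
    but not on [r].  With [k > a, b] this bounds the order of the links at [a] and
    then [b] by a natural number. *)

Require Import Defs.
From mathcomp Require Import all_boot all_order all_algebra finmap zify.
From mathcomp Require Import all_classical all_reals all_analysis.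

Set Implicit Arguments.
Unset Strict Implicit.
Unset Printing Implicit Defensive.

Import Order.TTheory GRing.Theory Num.Theory.

Local Open Scope ring_scope.

(** * Estimates for [d1] and for truncation *)

Notation point := (dsumZ * int)%type.

Lemma d1_sym (p q : point) : d1 p q = d1 q p.
Proof.
rewrite /d1 distrC; congr (_ + _).
by apply: eq_fsbigr => i _; rewrite distrC.
Qed.

Lemma d1_common_support (p q : point) : exists A : {fset int},
  [/\ (finsupp p.1 `<=` A)%fset, (finsupp q.1 `<=` A)%fset
    & d1 p q = \sum_(i <- A) `|p.1 i - q.1 i| + `|q.2 - p.2| ].
Proof.
exists (finsupp p.1 `|` finsupp q.1)%fset.
by rewrite -d1E ?fsubsetUl ?fsubsetUr.
Qed.

Lemma d1_triangle (q p s : point) : d1 p s <= d1 p q + d1 q s.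
Proof.
pose A := (finsupp p.1 `|` (finsupp q.1 `|` finsupp s.1))%fset.
have pA : (finsupp p.1 `<=` A)%fset by rewrite fsubsetUl.
have qA : (finsupp q.1 `<=` A)%fset by rewrite /A fsetUCA fsubsetUl.
have sA : (finsupp s.1 `<=` A)%fset by rewrite /A fsetUA fsubsetUr.
rewrite !(@d1E A)// addrACA -big_split/= lerD//; last by lia.
by apply: ler_sum => i _; exact: ler_distD.
Qed.

Lemma d1_xx (p : point) : d1 p p = 0.
Proof. by rewrite /d1 fsbig1 ?subrr// => i _; rewrite subrr normr0. Qed.

Lemma d1_layer_le (p q : point) : `|p.2 - q.2| <= d1 p q.
Proof.
have [A [_ _ ->]] := d1_common_support p q.
by rewrite distrC ler_wpDl// sumr_ge0.
Qed.

Lemma d1_coord_le (p q : point) i : `|p.1 i - q.1 i| <= d1 p q.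
Proof.
have [A [pA qA ->]] := d1_common_support p q.
rewrite ler_wpDr//; have [iA|iA] := boolP (i \in A).
  by rewrite (big_fsetD1 i)//= lerDl sumr_ge0.
rewrite !fsfun_dflt ?subrr ?normr0 ?sumr_ge0//.
  by apply: contraNN iA; exact: (fsubsetP qA).
by apply: contraNN iA; exact: (fsubsetP pA).
Qed.

Lemma point_eq (p q : point) : (forall i, p.1 i = q.1 i) -> p.2 = q.2 -> p = q.
Proof. by case: p q => [x a] [y b] /= xy ->; congr pair; exact/fsfunP. Qed.

Definition trunc (m : int) (p : point) : point :=
  ([fsfun i in finsupp p.1 => if m <= i then p.1 i else 0 | 0], p.2).

Lemma truncE m p i : (trunc m p).1 i = if m <= i then p.1 i else 0.
Proof. by rewrite /= fsfun_fun; case: finsuppP => //; case: ifP. Qed.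

Lemma finsupp_trunc m (p : point) : (finsupp (trunc m p).1 `<=` finsupp p.1)%fset.
Proof. exact: finsupp_sub. Qed.

Lemma d1_trunc_le m (p q : point) : d1 (trunc m p) (trunc m q) <= d1 p q.
Proof.
have [A [pA qA ->]] := d1_common_support p q.
rewrite (@d1E A) ?(fsubset_trans (finsupp_trunc m _))// lerD2r.
by apply: ler_sum => i _; rewrite !truncE; case: ifP; rewrite ?subrr ?normr0.
Qed.

(** Truncation loses only the differences in the [K] coordinates from [j] on, each at most [B]. *)
Lemma d1_le_trunc (j B : int) (K : nat) (p q : point) : 0 <= B ->
    (forall i, i < j -> p.1 i = q.1 i) ->
    (forall e, (e < K)%N -> `|p.1 (j + e%:Z) - q.1 (j + e%:Z)| <= B) ->
  d1 p q <= d1 (trunc (j + K%:Z) p) (trunc (j + K%:Z) q) + B *+ K.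
Proof.
move=> B0 pq0 pqB; have [A [pA qA ->]] := d1_common_support p q.
rewrite (@d1E A) ?(fsubset_trans (finsupp_trunc _ _))//= addrAC lerD2r.
rewrite (bigID (fun i => j <= i < j + K%:Z))/= addrC lerD//.
  rewrite [leRHS](bigID (fun i => j <= i < j + K%:Z))/= ler_wpDl ?sumr_ge0//.
  rewrite le_eqVlt; apply/orP; left; apply/eqP; apply: eq_bigr => i.
  rewrite !truncE negb_and -ltNge -leNgt => /orP[ij|->//].
  by rewrite pq0// subrr normr0; case: ifP; rewrite ?subrr ?normr0.
rewrite -big_filter; set s := [seq i <- A | _].
have sK : (size s <= K)%N.
  rewrite -[leqRHS](size_iota 0) -(size_map (fun e : nat => j + e%:Z)).
  apply: uniq_leq_size; first by rewrite filter_uniq.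
  move=> i; rewrite mem_filter => /andP[/andP[ji iK] _].
  apply/mapP; exists `|i - j|%N; last by lia.
  by rewrite mem_iota; lia.
apply: (@le_trans _ _ (B *+ size s)); last by rewrite ler_wpMn2l.
have -> : B *+ size s = \sum_(i <- s) B by rewrite big_const_seq iter_addr_0 count_predT.
rewrite big_seq [leRHS]big_seq; apply: ler_sum => i.
rewrite mem_filter => /andP[/andP[ji iK] _].
have -> : i = j + `|i - j|%N%:Z by lia.
by apply: pqB; lia.
Qed.

(** * Rigidity of points within one layer *)

Lemma dvdz_small (d x : int) : (d %| x)%Z -> `|x| < d -> x = 0.
Proof.
move=> /dvdzP[c ->] cd; have [->|c0] := eqVneq c 0; first by rewrite mul0r.
have d0 : 0 < d by exact: le_lt_trans cd.
by move: cd; rewrite normrM (gtr0_norm d0) ltNge ler_peMl//; lia.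
Qed.

Lemma eq_mod_close (d x y : int) :
  (x %% d)%Z = (y %% d)%Z -> `|x - y| < d -> x = y.
Proof.
move=> /eqP; rewrite eqz_mod_dvd => dxy xyd.
by apply/eqP; rewrite -subr_eq0; apply/eqP; exact: dvdz_small dxy xyd.
Qed.

Definition shift_point (p : point) : Prop :=
  (forall i, i < p.2 -> p.1 i = 0) /\
  (forall i, p.2 <= i -> (i - p.2 + 1 %| p.1 i)%Z).

Lemma shift_unionP (R : realType) p : shift_union R p <-> shift_point p.
Proof.
split=> [[j _ [<- //]]|[p0 pd]].
by exists p.2.
Qed.

Lemma shift_point_trunc m p : shift_point p -> shift_point (trunc m p).
Proof.
move=> [p0 pd]; split=> i ip; rewrite truncE; case: ifP => // _; first exact: p0.
exact: pd.
Qed.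

(** From index [p.2 + m] on, both coordinates are multiples of [i - p.2 + 1 > m], so a difference of
    at most [m] is zero. *)
Lemma shift_point_inj (m : nat) p q :
    shift_point p -> shift_point q -> p.2 = q.2 ->
    (forall i, i < p.2 + m%:Z -> p.1 i = q.1 i) -> d1 p q <= m%:Z ->
  p = q.
Proof.
move=> [_ pd] [_ qd] pq2 pq dm; apply: point_eq => // i.
have [/pq//|im] := ltP i (p.2 + m%:Z).
have ip : p.2 <= i by lia.
apply/eqP; rewrite -subr_eq0; apply/eqP.
apply: (@dvdz_small (i - p.2 + 1)).
  by rewrite rpredB ?pd// pq2 qd// -pq2.
by have := d1_coord_le p q i; lia.
Qed.

(** * Blocks of layers and their tiles *)

Section Blocks.
Variable k : nat.
Hypothesis k_gt0 : (0 < k)%N.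

Definition block (p : point) : int := (p.2 %/ k%:Z)%Z.
Definition base (p : point) : int := block p * k%:Z.
(** The summand [k] absorbs the position of a layer in its block: indices from [base p + width] on
    exceed every layer of the block by more than [k * k]. *)
Definition width : nat := (k * k + k)%N.
Definition tail (p : point) : point := trunc (base p + width%:Z) p.

Lemma block_eq_base p q : block p = block q -> base p = base q.
Proof. by rewrite /base => ->. Qed.

Lemma base_le p : base p <= p.2 < base p + k%:Z.
Proof.
rewrite /base /block {2 3}(divz_eq p.2 k%:Z) lerDl ltrD2l.
by rewrite modz_ge0 ?ltz_pmod//; lia.
Qed.

Definition offset (p : point) : nat := absz (p.2 - base p).

Lemma offset_lt p : (offset p < k)%N.
Proof. by have := base_le p; rewrite /offset; lia. Qed.

Lemma offset_inj p q : block p = block q -> offset p = offset q -> p.2 = q.2.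
Proof.
move=> /block_eq_base pq; have := base_le p; have := base_le q.
by rewrite /offset pq; lia.
Qed.

Definition tail_point p :=
  shift_point p /\ forall i, i < base p + width%:Z -> p.1 i = 0.

Lemma tail_pointP p : shift_point p -> tail_point (tail p).
Proof.
move=> sp; split; first exact: shift_point_trunc.
by move=> i ip; rewrite truncE leNgt ip.
Qed.

Lemma d1_tail_le p q : block p = block q -> d1 (tail p) (tail q) <= d1 p q.
Proof. by move=> /block_eq_base pq; rewrite /tail pq d1_trunc_le. Qed.

Lemma d1_le_tail p q (B : int) : 0 <= B -> shift_point p -> shift_point q ->
    block p = block q ->
    (forall e, (e < width)%N ->
       `|p.1 (base p + e%:Z) - q.1 (base q + e%:Z)| <= B) ->
  d1 p q <= d1 (tail p) (tail q) + B *+ width.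
Proof.
move=> B0 [p0 _] [q0 _] /block_eq_base pq pqB; rewrite /tail -pq.
apply: d1_le_trunc => // [i ip|e ew]; last by rewrite [in q.1 _]pq pqB.
have := base_le p; have := base_le q => lq lp; rewrite p0 ?q0; [by []|lia..].
Qed.

Definition step : rel point := fun p q =>
  `[< [/\ tail_point p, tail_point q, block p = block q & d1 p q < k%:Z] >].

Definition connected (p : point) : pred point := fun q =>
  `[< exists2 s, path step p s & q = last p s >].

(** A component is represented by one of its points: [choose] depends only on the extension of the
    predicate, so connected tails get the same point. *)
Definition tile (p : point) : point := choose (connected (tail p)) (tail p).

Lemma connected_refl p : connected p p.
Proof. by apply/asboolP; exists [::]. Qed.

Lemma connected_trans q p s : connected p q -> connected q s -> connected p s.
Proof.
move=> /asboolP[t1 pt1 ->] /asboolP[t2 pt2 ->]; apply/asboolP.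
by exists (t1 ++ t2); rewrite ?cat_path ?pt1// last_cat.
Qed.

Lemma step_sym : symmetric step.
Proof.
suff H p q : step p q -> step q p by move=> p q; apply/idP/idP; exact: H.
by move=> /asboolP[? ? ? pq]; apply/asboolP; split=> //; rewrite d1_sym.
Qed.

Lemma connected_sym p q : connected p q -> connected q p.
Proof.
move=> /asboolP[s ps ->]; apply/asboolP; exists (rev (belast p s)).
  by rewrite rev_path (eq_path (e' := step))// => ? ?; rewrite step_sym.
by case: s {ps} => //= x s; rewrite rev_cons last_rcons.
Qed.

Lemma path_tail_point p s : tail_point p -> path step p s ->
  {in p :: s, forall q, tail_point q /\ block q = block p}.
Proof.
elim: s p => [|q s IH] p tp /=; first by move=> _ q; rewrite inE => /eqP->.
move=> /andP[/asboolP[_ tq pq _] qs] x; rewrite inE => /predU1P[->//|xqs].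
by rewrite pq; exact: IH xqs.
Qed.

Lemma path_d1_le p s : path step p s ->
  {in p :: s &, forall x y, d1 x y <= (k * size s)%N%:Z}.
Proof.
elim: s p => [|q s IH] p /=.
  by move=> _ x y; rewrite !inE => /eqP-> /eqP->; rewrite d1_xx.
move=> /andP[/asboolP[_ _ _ pq] qs] x y.
have pz z : z \in q :: s -> d1 p z <= (k * (size s).+1)%N%:Z.
  move=> zs; apply: (le_trans (d1_triangle q p z)).
  by have := IH _ qs q z (mem_head _ _) zs; lia.
rewrite inE => /predU1P[->|xs]; rewrite inE => /predU1P[->|ys].
- by rewrite d1_xx.
- exact: pz.
- by rewrite d1_sym pz.
- by have := IH _ qs _ _ xs ys; lia.
Qed.

(* Points of one layer and distance at most [k * k] coincide, so a longer path
   would visit [k + 1] layers of a block. *)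
Lemma uniq_path_size p s : tail_point p -> path step p s -> uniq (p :: s) ->
  (size s < k)%N.
Proof.
move=> tp ps us; rewrite ltnNge; apply/negP => ks.
(* A path of exactly [k] steps has [k + 1] vertices, pairwise at most [k * k] apart. *)
pose s' := take k s.
have ps' : path step p s' by exact: take_path.
have us' : uniq (p :: s') by exact: (@take_uniq _ (p :: s) k.+1).
have ss' : size s' = k by rewrite size_takel.
have blk := path_tail_point tp ps'.
have inj : {in p :: s' &, injective offset}.
  move=> x y xs ys xy.
  have [[sx x0] bx] := blk _ xs; have [[sy y0] yb] := blk _ ys.
  have basex := block_eq_base bx; have basey := block_eq_base yb.
  have lx := base_le x.
  have xy2 : x.2 = y.2 by apply: offset_inj; rewrite // bx yb.
  apply: (@shift_point_inj (k * k)%N) => //.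
    by move=> i ix; rewrite x0 ?y0// ?basex ?basey /width; lia.
  by have := path_d1_le ps' xs ys; rewrite ss'.
have : (size (map offset (p :: s')) <= size (iota 0 k))%N.
  apply: uniq_leq_size; first by rewrite map_inj_in_uniq.
  move=> _ /mapP[q qs ->].
  by rewrite mem_iota offset_lt.
by rewrite size_map /= ss' size_iota ltnn.
Qed.

Lemma connected_d1_le p q : tail_point p -> connected p q ->
  [/\ tail_point q, block q = block p & d1 p q <= (k * k)%N%:Z].
Proof.
move=> tp /asboolP[s ps ->]; case/shortenP: ps => s' ps' us' _.
have [tq bq] := path_tail_point tp ps' (mem_last p s'); split=> //.
have := path_d1_le ps' (mem_head _ _) (mem_last p s').
by have := uniq_path_size tp ps' us'; nia.
Qed.

Lemma tileP p : shift_point p ->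
  [/\ tail_point (tile p), block (tile p) = block p
    & d1 (tail p) (tile p) <= (k * k)%N%:Z].
Proof.
move=> /tail_pointP tp; apply: (connected_d1_le (p := tail p)) tp _.
exact/chooseP/connected_refl.
Qed.

Lemma tile_eq_of_close p q : shift_point p -> shift_point q ->
  block p = block q -> d1 p q < k%:Z -> tile p = tile q.
Proof.
move=> sp sq pq dpq; have spq : connected (tail p) (tail q).
  apply/asboolP; exists [:: tail q] => //=; rewrite andbT; apply/asboolP.
  split=> //; [exact: tail_pointP|exact: tail_pointP|].
  exact: le_lt_trans (d1_tail_le pq) dpq.
rewrite /tile (@eq_choose _ (connected (tail p)) (connected (tail q))).
  by apply: choose_id => //; [exact: connected_sym|exact: connected_refl].
move=> x; apply/idP/idP; apply: connected_trans => //; exact: connected_sym.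
Qed.

Lemma d1_tail_tile p q : shift_point p -> shift_point q -> tile p = tile q ->
  d1 (tail p) (tail q) <= (2 * (k * k))%N%:Z.
Proof.
move=> sp sq pq; apply: (le_trans (d1_triangle (tile p) _ _)).
have [_ _] := tileP sp; have [_ _] := tileP sq.
by rewrite -pq (d1_sym (tail q)); lia.
Qed.

Lemma d1_tile_le p q : shift_point p -> shift_point q -> block p = block q ->
  d1 (tile p) (tile q) <= d1 p q + (2 * (k * k))%N%:Z.
Proof.
move=> sp sq pq; have [_ _ dp] := tileP sp; have [_ _ dq] := tileP sq.
have := d1_triangle (tail p) (tile p) (tile q).
have := d1_triangle (tail q) (tail p) (tile q).
have := d1_tail_le pq; rewrite (d1_sym (tile p) (tail p)); lia.
Qed.

(** * Coloring of tiles *)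

Section Color.
Variable r : nat.

(** Points of one block less than [r] apart have tile representatives at most this far apart. *)
Definition color_range : nat := (r + 2 * (k * k))%N.
Definition color_width : nat := (color_range + k)%N.
Definition color_type : finType :=
  ('I_k.+1 * {ffun 'I_color_width -> 'I_color_range.+1})%type.

Definition color (p : point) : color_type :=
  (inord (offset p),
   [ffun e : 'I_color_width =>
      inord (absz (p.1 (base p + (nat_of_ord e)%:Z) %% color_range.+1%:Z)%Z)]).

(** Equal offsets put both points in one layer. The recorded coordinates agree modulo
    [color_range + 1] and differ by at most [color_range], hence agree; the later ones are settled
    by [shift_point_inj]. *)
Lemma color_inj p q : tail_point p -> tail_point q -> block p = block q ->
  d1 p q <= color_range%:Z -> color p = color q -> p = q.
Proof.
move=> [sp p0] [sq q0] bpq dpq []; have pq := block_eq_base bpq.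
have lp := base_le p.
move=> /(congr1 (@nat_of_ord _)); rewrite !inordK ?ltnS 1?ltnW ?offset_lt// => opq /ffunP cpq.
apply: (@shift_point_inj color_range) => //; first exact: offset_inj.
move=> i ip; have [ib|ib] := ltP i (base p).
  by rewrite p0 ?q0 -?pq /width; lia.
have ew : (`|i - base p| < color_width)%N by rewrite /color_width; lia.
have := cpq (Ordinal ew); rewrite !ffunE /= -pq => /(congr1 (@nat_of_ord _)).
have -> : base p + (absz (i - base p))%:Z = i by lia.
have md x : 0 <= (x %% color_range.+1%:Z)%Z < color_range.+1%:Z.
  by rewrite modz_ge0 ?ltz_pmod.
rewrite !inordK; [|by have := md (p.1 i); have := md (q.1 i); lia..].
move=> e; apply: (@eq_mod_close color_range.+1%:Z).
  by have := md (p.1 i); have := md (q.1 i); lia.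
by have := d1_coord_le p q i; lia.
Qed.

End Color.
End Blocks.

(** * Distances between cells of a grid in the integers *)

Lemma eq_divz_close (d x y : int) : 0 < d -> (x %/ d)%Z = (y %/ d)%Z ->
  `|x - y| <= d.
Proof.
move=> d0 xy; have := @ltz_pmod x _ d0; have := @ltz_pmod y _ d0.
have := @modz_ge0 x d; have := @modz_ge0 y d.
rewrite (gt_eqF d0) => /(_ isT) y0 /(_ isT) x0.
rewrite {2}(divz_eq x d) {2}(divz_eq y d) xy.
by move: y0 x0; lia.
Qed.

Lemma neq_mod_far (d x y : int) : (x %% d)%Z = (y %% d)%Z -> x <> y ->
  d <= `|x - y|.
Proof. by move=> xyd; rewrite leNgt; apply: contra_notN; exact: eq_mod_close. Qed.

(** The larger number lies at least [m] above the start of its cell, and the smaller one lies below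
    that start. *)
Lemma neq_divz_far (d m x y : int) : 0 < d -> (x %/ d)%Z <> (y %/ d)%Z ->
  m <= (x %% d)%Z -> m <= (y %% d)%Z -> m <= `|x - y|.
Proof.
move=> d0; have := @ltz_pmod x _ d0; have := @ltz_pmod y _ d0.
have := divz_eq x d; have := divz_eq y d.
move: (x %/ d)%Z (y %/ d)%Z (x %% d)%Z (y %% d)%Z => a b u v yE xE vd ud ab mu mv.
have step i j : i < j -> (i + 1) * d <= j * d by move=> ij; rewrite ler_pM2r//; lia.
by have [/step|/step|//] := ltrgtP a b; lia.
Qed.

(** Distinct cell indices of equal parity differ by at least two, so a whole cell of length [d]
    separates the numbers. *)
Lemma eq_parity_divz_far (d x y : int) : 0 < d -> (x %/ d)%Z <> (y %/ d)%Z ->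
  ((x %/ d)%Z %% 2)%Z = ((y %/ d)%Z %% 2)%Z -> d <= `|x - y|.
Proof.
move=> d0 xy /neq_mod_far/(_ xy).
have := @ltz_pmod x _ d0; have := @ltz_pmod y _ d0.
have := @modz_ge0 x d; have := @modz_ge0 y d.
rewrite (gt_eqF d0) => /(_ isT) y0 /(_ isT) x0 xd yd.
have := divz_eq x d; have := divz_eq y d.
move: x0 y0 xd yd.
move: (x %/ d)%Z (y %/ d)%Z (x %% d)%Z (y %% d)%Z => a b u v u0 v0 ud vd yE xE ab.
have step i j : i + 2 <= j -> (i + 2) * d <= j * d by move=> ij; rewrite ler_pM2r.
have [/step|/step] : a + 2 <= b \/ b + 2 <= a by lia.
  by lia.
by lia.
Qed.

(** * Good and bad points relative to the shifted grids *)

Section Cover.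
Variables k r : nat.
Hypotheses (k_gt0 : (0 < k)%N) (r_gt0 : (0 < r)%N).

Notation width := (width k).
Notation block := (block k).
Notation base := (base k).
Notation tile := (tile k).
Notation ncolors := #|color_type k r|.

Definition head (p : point) (e : nat) : int := p.1 (base p + e%:Z).
(** The shifts are [1, ..., ncolors] times [r + k], and [period] leaves room for two more such
    units. So grids with different shifts stay at least [r + k] apart from each other, and every
    grid stays that far from 0; an error below [k] still leaves [r]. *)
Definition shift (p : point) : int :=
  ((enum_rank (color k r (tile p))).+1 * (r + k))%N%:Z.
Definition period : int := (ncolors.+2 * (r + k))%N%:Z.
Definition phase (p : point) (e : nat) : int := ((head p e - shift p) %% period)%Z.
Definition good (p : point) : Prop := forall e, (e < width)%N -> k%:Z <= phase p e.

Lemma period_gt0 : 0 < period.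
Proof. by rewrite /period ltz_nat muln_gt0 addn_gt0 r_gt0. Qed.

Lemma shift_bounds p : (r + k)%N%:Z <= shift p <= (ncolors * (r + k))%N%:Z.
Proof.
rewrite /shift !lez_nat leq_mul2r ltn_ord orbT andbT.
by rewrite -[leqLHS]mul1n leq_mul2r orbT.
Qed.

Lemma shift_far p q : shift_point p -> shift_point q -> block p = block q ->
  tile p <> tile q -> d1 p q < r%:Z -> (r + k)%N%:Z <= `|shift p - shift q|.
Proof.
move=> sp sq pq tpq dpq.
have [tp btp _] := tileP k_gt0 sp; have [tq btq _] := tileP k_gt0 sq.
have : enum_rank (color k r (tile p)) != enum_rank (color k r (tile q)).
  apply/eqP => /enum_rank_inj cpq; apply: tpq; apply: color_inj cpq => //.
    by rewrite btp btq.
  by have := d1_tile_le k_gt0 sp sq pq; rewrite /color_range; lia.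
rewrite -(inj_eq val_inj)/= /shift.
move: (nat_of_ord _) (nat_of_ord _) => i j; rewrite neq_ltn => /orP[]; nia.
Qed.

Lemma small_phase p e : phase p e < k%:Z ->
  exists b c : int, head p e = shift p + b * period + c /\ 0 <= c < k%:Z.
Proof.
move=> pk; exists ((head p e - shift p) %/ period)%Z, (phase p e).
rewrite pk /phase modz_ge0 ?gt_eqF ?period_gt0//; split=> //.
by rewrite -addrA -divz_eq; lia.
Qed.

Lemma small_phase_head p e : phase p e < k%:Z -> r%:Z <= `|head p e|.
Proof.
move=> /small_phase[b [c [-> ck]]]; have := shift_bounds p.
by rewrite /period; have [b0|b0] := leP 0 b; nia.
Qed.

Lemma small_phase_far p q e : phase p e < k%:Z -> phase q e < k%:Z ->
  (r + k)%N%:Z <= `|shift p - shift q| -> r%:Z <= `|head p e - head q e|.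
Proof.
move=> /small_phase[b [c [-> ck]]] /small_phase[b' [c' [-> ck']]].
have := shift_bounds p; have := shift_bounds q; rewrite /period.
by have [bb|bb|->] := ltrgtP b b'; nia.
Qed.

Lemma head_le p q e : block p = block q -> `|head p e - head q e| <= d1 p q.
Proof.
by move=> /block_eq_base pq; rewrite /head pq; exact: d1_coord_le.
Qed.

Lemma d1_le_head p q (B : int) : 0 <= B -> shift_point p -> shift_point q ->
    block p = block q -> tile p = tile q ->
    (forall e, (e < width)%N -> `|head p e - head q e| <= B) ->
  d1 p q <= (2 * (k * k))%N%:Z + B *+ width.
Proof.
move=> B0 sp sq pq tpq pqB; apply: (le_trans (d1_le_tail k_gt0 B0 sp sq pq pqB)).
by rewrite lerD2r d1_tail_tile.
Qed.

(** Each class of points is cut into the members of a family by the values of such a label. *)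
Definition label (f : point -> nat -> int) (p : point) :=
  (block p, tile p, [ffun e : 'I_width => f p e]).

Definition good_label := label (fun p e => ((head p e - shift p) %/ period)%Z).
Definition bad_label := label (fun p e => (head p e %/ r%:Z)%Z).

Lemma good_d1_le p q : shift_point p -> shift_point q ->
  good_label p = good_label q -> d1 p q <= (2 * (k * k))%N%:Z + period *+ width.
Proof.
move=> sp sq [pq tpq /ffunP fpq]; apply: d1_le_head => //.
(* Equal tiles give equal shifts, so both head coordinates lie in one cell of the same grid. *)
move=> e ew; have := fpq (Ordinal ew); rewrite !ffunE /= /shift tpq.
move=> /(eq_divz_close period_gt0); congr (`|_| <= _); lia.
Qed.

(** Distinct blocks of equal parity have a whole block of [k] layers between them; distinct tiles of
    one block are [k] apart by construction; points of one tile share a grid, and good heads in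
    different cells of it are [k] apart. *)
Lemma good_far p q : shift_point p -> shift_point q -> good p -> good q ->
    (block p %% 2)%Z = (block q %% 2)%Z -> good_label p <> good_label q ->
  k%:Z <= d1 p q.
Proof.
move=> sp sq gp gq p2 lpq; have [pq|/eqP pq] := eqVneq (block p) (block q); last first.
  apply: (le_trans _ (d1_layer_le p q)).
  have := base_le k_gt0 p; have := base_le k_gt0 q; rewrite /base.
  by have := neq_mod_far p2 pq; nia.
have [tpq|/eqP tpq] := eqVneq (tile p) (tile q); last first.
  by rewrite leNgt; apply/negP => dpq; apply: tpq; exact: tile_eq_of_close.
have [e fe] : exists e : 'I_width, ((head p e - shift p) %/ period)%Z <>
                                 ((head q e - shift q) %/ period)%Z.
  apply: contra_notP lpq => /forallNP fe.
  rewrite /good_label /label pq tpq; congr (_, _); apply/ffunP => e.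
  by rewrite !ffunE; apply: contrapT (fe e).
have := neq_divz_far period_gt0 fe (gp _ (ltn_ord e)) (gq _ (ltn_ord e)).
have -> : shift q = shift p by rewrite /shift tpq.
by have := head_le e pq; lia.
Qed.

Lemma bad_d1_le p q : shift_point p -> shift_point q ->
  bad_label p = bad_label q -> d1 p q <= (2 * (k * k))%N%:Z + r%:Z *+ width.
Proof.
move=> sp sq [pq tpq /ffunP fpq]; apply: d1_le_head => // e ew.
have := fpq (Ordinal ew); rewrite !ffunE /=.
by apply: eq_divz_close; rewrite ltz_nat.
Qed.

Definition bad (e w : 'I_width) (v : {ffun 'I_width -> 'I_2}) (p : point) : Prop :=
  [/\ phase p e < k%:Z, (block p %% width%:Z)%Z = (w : nat)%:Z
    & forall e' : 'I_width, ((head p e' %/ r%:Z)%Z %% 2)%Z = (v e' : nat)%:Z].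

Lemma good_or_bad p : good p \/ exists e w v, bad e w v p.
Proof.
have [|/existsNP[e /not_implyP[ew /negP pe]]] := pselect (good p); [by left|right].
have w0 : width%:Z != 0 by lia.
have mw : (absz (block p %% width%:Z)%Z < width)%N.
  have := @ltz_pmod (block p) width%:Z; have := modz_ge0 (block p) w0; lia.
exists (Ordinal ew), (Ordinal mw),
  [ffun e : 'I_width => inord (absz ((head p e %/ r%:Z)%Z %% 2)%Z)].
split=> /= [||e']; first by rewrite ltNge.
- by have := modz_ge0 (block p) w0; lia.
- have := @ltz_pmod (head p e' %/ r%:Z)%Z 2; have := @modz_ge0 (head p e' %/ r%:Z)%Z 2.
  by rewrite ffunE inordK; lia.
Qed.

Lemma bad_far_block e w v p q : shift_point q -> bad e w v p -> bad e w v q ->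
  block p < block q -> r%:Z <= d1 p q.
Proof.
move=> [q0 _] [pe pw _] [_ qw _] pq; apply: (le_trans (small_phase_head pe)).
have : q.1 (base p + (e : nat)%:Z) = 0.
  apply: q0; have := base_le k_gt0 q; have := ltn_ord e; rewrite /base.
  (* Distinct block indices congruent modulo [width] differ by at least [width], so [base p + e]
     lies below the layer of [q]. *)
  have := @neq_mod_far width%:Z (block p) (block q); rewrite pw qw => /(_ erefl).
  move=> wpq; have : (block p + width%:Z) * k%:Z <= block q * k%:Z.
    by rewrite ler_pM2r//; lia.
  have : width%:Z * 1 <= width%:Z * k%:Z by rewrite ler_wpM2l.
  by rewrite mulrDl; lia.
move=> qe; have := d1_coord_le p q (base p + (e : nat)%:Z).
by rewrite qe subr0.
Qed.

Lemma bad_far e w v p q : shift_point p -> shift_point q -> bad e w v p -> bad e w v q ->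
  bad_label p <> bad_label q -> r%:Z <= d1 p q.
Proof.
move=> sp sq bp bq lpq; case: (ltrgtP (block p) (block q)) => pq.
- exact: bad_far_block bp bq pq.
- by rewrite d1_sym; exact: bad_far_block bq bp pq.
have [pe _ pv] := bp; have [qe _ qv] := bq.
have [tpq|/eqP tpq] := eqVneq (tile p) (tile q); last first.
  rewrite leNgt; apply/negP => dpq; have spq := shift_far sp sq pq tpq dpq.
  by have := small_phase_far pe qe spq; have := head_le e pq; lia.
(* Within one tile some cell index of side [r] differs, and [v] fixes its parity. *)
have [e' fe] : exists e' : 'I_width, (head p e' %/ r%:Z)%Z <> (head q e' %/ r%:Z)%Z.
  apply: contra_notP lpq => /forallNP fe.
  rewrite /bad_label /label pq tpq; congr (_, _); apply/ffunP => e'.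
  by rewrite !ffunE; apply: contrapT (fe e').
apply: le_trans (head_le e' pq); apply: eq_parity_divz_far => //.
by rewrite pv qv.
Qed.

End Cover.

(** * Families of level sets *)

Section LevelFamily.
Variables (R : realType) (X : metricType R) (T : Type).
Variables (P : X -> Prop) (l : X -> T).

Definition level_family : set (set X) :=
  [set U | exists a, U = [set x | P x /\ l x = a]%classic]%classic.

Lemma level_family_bounded (B : R) :
    (forall x y, P x -> P y -> l x = l y -> mdist x y <= B) ->
  uniformly_bounded level_family.
Proof.
(* [uniformly_bounded] asks for a positive radius, which [B] need not be. *)
move=> PB; exists (Num.max 1 B); first by rewrite lt_max ltr01.
move=> _ [a ->]; apply: ge_ereal_sup => _ [x [Px xa]] [y [Py ya] <-].
by rewrite lee_fin le_max PB ?orbT// xa ya.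
Qed.

Lemma level_family_disjoint (r : R) :
    (forall x y, P x -> P y -> l x <> l y -> r <= mdist x y) ->
  disjoint_family r level_family.
Proof.
move=> Pr _ _ [a ->] [b ->] ab; apply: le_ereal_inf_tmp => _ [x [Px xa]] [y [Py yb] <-].
rewrite lee_fin; apply: Pr => // lxy; apply: ab.
by rewrite -xa -yb lxy.
Qed.

Lemma level_family_cover x : P x -> (\bigcup_(U in level_family) U)%classic x.
Proof. by move=> Px; exists [set y | P y /\ l y = l x]%classic => //; exists (l x). Qed.

End LevelFamily.

(** * The covering families of the shift union *)

Notation bad_index k :=
  ('I_(width k) * 'I_(width k) * {ffun 'I_(width k) -> 'I_2})%type.

Section ShiftUnion.
Variable R : realType.
Notation X := (set_type (shift_union R)).

Lemma shift_union_point (x : X) : shift_point (val x).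
Proof. by have /shift_unionP := set_valP x. Qed.

Lemma mdist_shift_union (x y : X) :
  mdist x y = (d1 (val x : point) (val y : point))%:~R.
Proof. by []. Qed.

(** The number of bad classes does not depend on [r], so [r] may be chosen after [t], and [t] is
    large enough to give each class its own index. *)
Lemma shift_union_families (k : nat) (t : {fset nat}) : (0 < k)%N ->
    (#|{: bad_index k}| <= #|` t|)%N ->
  exists (G : 'I_2 -> set (set X)) (F : nat -> set (set X)),
    [/\ forall c, uniformly_bounded (G c) /\ disjoint_family k%:R (G c),
        forall i, i \in t -> uniformly_bounded (F i) /\ disjoint_family i%:R (F i)
      & forall x, (exists c, (\bigcup_(U in G c) U)%classic x) \/
          (exists2 i, i \in t & (\bigcup_(U in F i) U)%classic x)].
Proof.
(* Since [r] exceeds every element of [t], an [r]-disjoint family is [i]-disjoint for each [i] in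
   [t]. *)
move=> k_gt0 kt; pose r := (\max_(i <- t) i).+1.
pose Pgood (c : 'I_2) (x : X) :=
  good k r (val x) /\ (block k (val x) %% 2)%Z = (c : nat)%:Z.
(* The position of [i] in [t] selects the bad class; surplus elements of [t] get only empty
   members. *)
pose Pbad i (x : X) := exists2 f : bad_index k,
  index i t = enum_rank f & bad r f.1.1 f.1.2 f.2 (val x).
exists (fun c => level_family (Pgood c) (fun x => good_label k r (val x))).
exists (fun i => level_family (Pbad i) (fun x => bad_label k r (val x))).
split.
- move=> c; split.
    apply: (@level_family_bounded _ _ _ _ _ ((2 * (k * k))%N%:Z + period k r *+ width k)%:~R).
    move=> x y _ _ xy; rewrite mdist_shift_union ler_int.
    by apply: good_d1_le xy => //; exact: shift_union_point.
  apply: level_family_disjoint => x y [gx cx] [gy cy] xy.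
  rewrite mdist_shift_union -[k%:R]/(k%:Z%:~R) ler_int.
  apply: good_far xy => //; [exact: shift_union_point..|by rewrite cx cy].
- move=> i it; split.
    apply: (@level_family_bounded _ _ _ _ _ ((2 * (k * k))%N%:Z + r%:Z *+ width k)%:~R).
    move=> x y _ _ xy; rewrite mdist_shift_union ler_int.
    by apply: bad_d1_le xy => //; exact: shift_union_point.
  apply: level_family_disjoint => x y [f fi bx] [g gi bgy] xy.
  have fg : f = g by apply/enum_rank_inj/val_inj; rewrite /= -fi -gi.
  rewrite -fg in bgy; apply: (@le_trans _ _ r%:R).
    by rewrite ler_nat /r leqW// leq_bigmax_seq.
  rewrite mdist_shift_union -[r%:R]/(r%:Z%:~R) ler_int.
  by apply: (bad_far _ _ _ _ bx bgy xy) => //; exact: shift_union_point.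
- move=> x; have [gx|[e [w [v bx]]]] := good_or_bad k_gt0 (isT : (0 < r)%N) (val x).
    left; have := @ltz_pmod (block k (val x)) 2; have := @modz_ge0 (block k (val x)) 2.
    move=> /(_ isT) c0 /(_ isT) c2.
    exists (inord (absz (block k (val x) %% 2)%Z)); apply: level_family_cover.
    by split=> //; rewrite inordK; lia.
  have it : (enum_rank (e, w, v) < #|` t|)%N := leq_trans (ltn_ord _) kt.
  right; exists (nth 0%N t (enum_rank (e, w, v))); first by rewrite mem_nth.
  by apply: level_family_cover; exists (e, w, v); rewrite // index_uniq.
Qed.

End ShiftUnion.

(** * The bound on the order *)

Lemma ozero_le x : ole ozero x.
Proof. by case: x => B g []. Qed.

(** Adjoining [a] to a set of the link gives a set of [M] with one more element, so each link lowers
    the bound by one. *)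
Lemma Ord_le_nat n (M : set {fset nat}) :
    (forall t, M t -> FinN t /\ (#|` t| <= n)%N) -> Ord_le M (ord_of_nat n).
Proof.
elim: n M => [|n IH] M Mn.
  apply: Ord_le_zero => //; rewrite -subset0 => t /Mn[/=].
  by rewrite leqn0 cardfs_eq0 => /negP.
apply: Ord_le_pos => [|a]; first by exists tt; exact: ozero_le.
exists (ord_of_nat n); first by exists tt; exact: ole_refl.
apply: IH => t [t0 /Mn[_ ta] at_]; split=> //.
by move: ta; rewrite fsetUC cardfsU1 at_.
Qed.

Theorem proposition5p1 (R : realType) :
  trasdim_le (set_type (shift_union R)) (osucc omega).
Proof.
apply: Ord_le_pos => [|a]; first by exists tt; exact: ozero_le.
(* It remains to bound the link at [a] by [omega]: its link at each [b] needs a finite bound, which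
   may depend on [a] and [b]. *)
exists omega; first by exists tt; exact: ole_refl.
apply: Ord_le_pos => [|b]; first by exists 0%N; exact: ozero_le.
(* As [k] exceeds [a] and [b], the two [k]-disjoint good families can serve the indices [a] and
   [b]. *)
pose k := (a + b).+1.
pose n := #|{: bad_index k}|.
exists (ord_of_nat n); first by exists n; exact: ole_refl.
apply: Ord_le_nat => t [t0 [_ [_ tA] atb] bt]; split=> //.
(* With more than [n] elements, [t] has room for all bad classes, and the resulting cover
   contradicts membership in [asdim_set]. *)
rewrite leqNgt; apply/negP => /ltnW nt; apply: tA.
have [G [F [GP FP GF]]] := @shift_union_families R k t isT nt.
move: atb; rewrite !inE negb_or => /andP[at_ ab].
exists (fun i => if i == a then G ord0 else if i == b then G ord_max else F i).
have small c i : (i <= k)%N -> uniformly_bounded (G c) /\ disjoint_family i%:R (G c).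
  move=> ik; have [Gb Gd] := GP c; split=> // U V GU GV UV.
  by apply: le_trans (Gd _ _ GU GV UV); rewrite lee_fin ler_nat.
split=> [i|].
  have [-> _|ia] := eqVneq i a; first by apply: small; rewrite /k; lia.
  have [-> _|ib] := eqVneq i b; first by apply: small; rewrite /k; lia.
  by rewrite !inE (negPf ia) (negPf ib) !orbF; exact: FP.
rewrite -subTset => x _; have [[c Gx]|[i it Fx]] := GF x.
  have [c0|c1] : c = ord0 \/ c = ord_max.
    by case: c {Gx} => -[|[|//]] ?; [left|right]; exact: val_inj.
  - by exists a; rewrite /= ?inE ?eqxx ?orbT// -c0.
  - by exists b; rewrite /= ?inE ?eqxx ?orbT// eq_sym (negPf ab) -c1.
exists i; first by rewrite /= !inE it.
have -> : (i == a) = false by apply: contraNF at_ => /eqP <-.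
by have -> : (i == b) = false by apply: contraNF bt => /eqP <-.
Qed.
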